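(* A functor $w\colon A\to B$ between quasi-categories is a weak equivalence in the Joyal model structure on simplicial sets if and only if it is an equivalence in the 2-category $\mathrm{qCat}_2$.
   Context: A quasi-category is a simplicial set with fillers for all inner horns; functors are simplicial maps between quasi-categories. $h\colon\mathrm{sSet}\to\mathrm{Cat}$ is left adjoint to the nerve. $\mathrm{qCat}_2$ is the strict 2-category whose objects are quasi-categories and whose hom-categories are $\hom'(A,B)=h(B^A)$, with $B^A$ the internal hom of simplicial sets. A simplicial map $w\colon X\to Y$ is a weak equivalence in the Joyal model structure if and only if $h(Q^w)\colon h(Q^Y)\to h(Q^X)$ is an equivalence of categories for every quasi-category $Q$. A 1-cell $w\colon A\to B$ of a 2-category is an equivalence if there is a 1-cell $w'\colon B\to A$ and invertible 2-cells $ww'\cong\mathrm{id}_B$ and $w'w\cong\mathrm{id}_A$. *)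

(* Defs.v *)
From HB Require Import structures.
From mathcomp Require Import all_boot all_order.
From mathcomp Require Import generic_quotient boolp.

Set Implicit Arguments.
Unset Strict Implicit.
Unset Printing Implicit Defensive.

Import Order.TTheory.
Local Open Scope quotient_scope.

Record category := Category {
  obj :> Type;
  hom : obj -> obj -> Type;
  idm : forall x, hom x x;
  comp : forall x y z, hom y z -> hom x y -> hom x z;
  comp1m : forall x y (f : hom x y), comp (idm y) f = f;
  compm1 : forall x y (f : hom x y), comp f (idm x) = f;
  compA : forall x y z t (f : hom x y) (g : hom y z) (k : hom z t),
    comp k (comp g f) = comp (comp k g) f }.
Arguments hom {c} x y.
Arguments idm {c} x.
Arguments comp {c x y z} g f.

Record functor (C D : category) := Functor {
  fobj :> C -> D;
  fhom : forall x y, hom x y -> hom (fobj x) (fobj y);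
  fhom_id : forall x, fhom (idm x) = idm (fobj x);
  fhom_comp : forall x y z (g : hom y z) (f : hom x y),
    fhom (comp g f) = comp (fhom g) (fhom f) }.
Arguments fhom {C D} F {x y} f : rename.

(* Arrows with their endpoints: [arr f = arr g] compares arrows whose endpoints
   are only propositionally equal. *)
Definition arr (C : category) (x y : C) (f : hom x y) :
  {x : C & {y : C & hom x y}} := existT _ x (existT _ y f).

Lemma arr_inj (C : category) (x y : C) (f g : hom x y) : arr f = arr g -> f = g.
Proof.
have key (T : Type) (P : T -> Type) t (a b : P t) :
    existT P t a = existT P t b -> a = b.
  move=> e; rewrite -[RHS](projT2_eq e) /=.
  by rewrite (Prop_irrelevance (projT1_eq e) erefl).
by move=> /(key _ (fun a => {b : C & hom a b})) /(key _ (hom x)).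
Qed.

Lemma arr_comp (C : category) (x y z x' y' z' : C) (f : hom x y) (g : hom y z)
    (f' : hom x' y') (g' : hom y' z') :
  arr f = arr f' -> arr g = arr g' -> arr (comp g f) = arr (comp g' f').
Proof.
move=> ef; have ex := f_equal (@projT1 _ _) ef.
have ey := f_equal (fun a => projT1 (projT2 a)) ef; move: ex ey ef => /= ex ey.
subst x' y' => /arr_inj <- eg.
have ez := f_equal (fun a => projT1 (projT2 a)) eg; move: ez eg => /= ez.
by subst z' => /arr_inj <-.
Qed.

Lemma arr_id (C : category) (x y : C) : x = y -> arr (idm x) = arr (idm y).
Proof. by move=> ->. Qed.

Lemma arr_fhom (C D : category) (F : functor C D) (x y x' y' : C)
    (f : hom x y) (f' : hom x' y') : arr f = arr f' -> arr (fhom F f) = arr (fhom F f').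
Proof.
move=> ef; have ex := f_equal (@projT1 _ _) ef.
have ey := f_equal (fun a => projT1 (projT2 a)) ef; move: ex ey ef => /= ex ey.
by subst x' y' => /arr_inj <-.
Qed.

Lemma functor_eq (C D : category) (F G : functor C D) :
  (forall (x y : C) (f : hom x y), arr (fhom F f) = arr (fhom G f)) -> F = G.
Proof.
case: F => Fo Fh F1 Fc; case: G => Go Gh G1 Gc /= eFG.
have eo : Fo = Go.
  apply: funext => x; exact: (f_equal (@projT1 _ _) (eFG x x (idm x))).
subst Go.
have eh : Fh = Gh.
  apply: functional_extensionality_dep => x.
  apply: functional_extensionality_dep => y.
  by apply: functional_extensionality_dep => f; apply: arr_inj.
by subst Gh; congr Functor; apply: Prop_irrelevance.
Qed.

Definition fid (C : category) : functor C C.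
Proof. by refine (@Functor C C id (fun _ _ f => f) _ _). Defined.
Arguments fid {C}.

Definition fcomp (C D E : category) (G : functor D E) (F : functor C D) : functor C E.
Proof.
refine (@Functor C E (fun x => G (F x)) (fun _ _ f => fhom G (fhom F f)) _ _).
- by move=> x; rewrite !fhom_id.
- by move=> x y z g f; rewrite !fhom_comp.
Defined.

Lemma fcompA (B C D E : category) (F : functor B C) (G : functor C D) (H : functor D E) :
  fcomp H (fcomp G F) = fcomp (fcomp H G) F.
Proof. exact: functor_eq. Qed.

Lemma fcompf1 (C D : category) (F : functor C D) : fcomp F fid = F.
Proof. exact: functor_eq. Qed.

Lemma fcomp1f (C D : category) (F : functor C D) : fcomp fid F = F.
Proof. exact: functor_eq. Qed.

Definition fconst (C D : category) (d : D) : functor C D.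
Proof.
by refine (@Functor C D (fun=> d) (fun _ _ _ => idm d) _ _) => // *; rewrite comp1m.
Defined.

Definition is_iso (C : category) (x y : C) (f : hom x y) :=
  exists g : hom y x, comp g f = idm x /\ comp f g = idm y.

Definition nat_iso (C D : category) (F G : functor C D) :=
  exists t : forall x, hom (F x) (G x),
    (forall x y (f : hom x y), comp (t y) (fhom F f) = comp (fhom G f) (t x))
    /\ (forall x, is_iso (t x)).

Definition equivalence_of_categories (C D : category) (F : functor C D) :=
  exists G : functor D C, nat_iso (fcomp G F) fid /\ nat_iso (fcomp F G) fid.

Definition prodC (C D : category) : category.
Proof.
refine (@Category (C * D)%type (fun x y => hom x.1 y.1 * hom x.2 y.2)%type
  (fun x => (idm x.1, idm x.2)) (fun _ _ _ g f => (comp g.1 f.1, comp g.2 f.2)) _ _ _).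
- by move=> x y [f g]; rewrite !comp1m.
- by move=> x y [f g]; rewrite !compm1.
- by move=> *; rewrite !compA.
Defined.

Definition ffst (C D : category) : functor (prodC C D) C.
Proof. by refine (@Functor (prodC C D) C fst (fun _ _ f => f.1) _ _). Defined.

Definition fsnd (C D : category) : functor (prodC C D) D.
Proof. by refine (@Functor (prodC C D) D snd (fun _ _ f => f.2) _ _). Defined.

Definition fpair (B C D : category) (F : functor B C) (G : functor B D) :
  functor B (prodC C D).
Proof.
refine (@Functor B (prodC C D) (fun x => (F x, G x))
  (fun _ _ f => (fhom F f, fhom G f)) _ _).
- by move=> x; rewrite !fhom_id.
- by move=> *; rewrite !fhom_comp.
Defined.

Definition fprod (C D C' D' : category) (F : functor C C') (G : functor D D') :
  functor (prodC C D) (prodC C' D') :=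
  fpair (fcomp F (@ffst C D)) (fcomp G (@fsnd C D)).

Definition fassoc (C D E : category) :
  functor (prodC (prodC C D) E) (prodC C (prodC D E)) :=
  fpair (fcomp (@ffst C D) (@ffst _ E))
        (fpair (fcomp (@fsnd C D) (@ffst _ E)) (@fsnd _ E)).

(* A strict 2-category, presented as a category enriched in [Cat]. *)
Record strict2cat := Strict2cat {
  obj2 :> Type;
  hom2 : obj2 -> obj2 -> category;
  id2 : forall A, hom2 A A;
  comp2 : forall A B C, functor (prodC (hom2 B C) (hom2 A B)) (hom2 A C);
  comp2A : forall A B C D,
    fcomp (comp2 A B D) (fprod (comp2 B C D) fid)
    = fcomp (fcomp (comp2 A C D) (fprod fid (comp2 A B C)))
            (@fassoc (hom2 C D) (hom2 B C) (hom2 A B));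
  comp21m : forall A B, fcomp (comp2 A B B) (fpair (fconst _ (id2 B)) fid) = fid;
  comp2m1 : forall A B, fcomp (comp2 A A B) (fpair fid (fconst _ (id2 A))) = fid }.
Arguments hom2 {s} A B.
Arguments id2 {s} A.
Arguments comp2 {s} A B C.

Definition iso2 (K : strict2cat) (A B : K) (f g : hom2 A B) :=
  exists a : hom f g, is_iso a.

Definition equivalence2 (K : strict2cat) (A B : K) (w : hom2 A B) :=
  exists w' : hom2 B A,
    iso2 (comp2 B A B (w, w')) (id2 B) /\ iso2 (comp2 A B A (w', w)) (id2 A).

Definition delta (m n : nat) := {omorphism 'I_m.+1 -> 'I_n.+1}.

Lemma delta_eq m n (a b : delta m n) : a =1 b -> a = b.
Proof.
case: a => a [[aP]]; case: b => b [[bP]] /= /funext eab; subst b.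
by rewrite (Prop_irrelevance aP bP).
Qed.

Definition mk_delta m n (f : 'I_m.+1 -> 'I_n.+1)
    (fP : forall i j : 'I_m.+1, (i <= j)%N -> (f i <= f j)%N) : delta m n :=
  HB.pack f (Order.isOrderMorphism.Build _ _ _ _ f fP).

Lemma delta_le m n (a : delta m n) (i j : 'I_m.+1) : (i <= j)%N -> (a i <= a j)%N.
Proof. exact: (@omorph_le _ _ _ _ a i j). Qed.

Definition delta_id n : delta n n := idfun.
Definition delta_comp m n p (a : delta n p) (b : delta m n) : delta m p := a \o b.

Record sSet := SSet {
  simplices :> nat -> Type;
  act : forall m n, delta m n -> simplices n -> simplices m;
  act_id : forall n (x : simplices n), act (delta_id n) x = x;
  act_comp : forall m n p (a : delta n p) (b : delta m n) (x : simplices p),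
    act (delta_comp a b) x = act b (act a x) }.
Arguments act {s m n} a x.

Record smap (X Y : sSet) := SMap {
  sfun :> forall n, X n -> Y n;
  sfunP : forall m n (a : delta m n) (x : X n), sfun (act a x) = act a (sfun x) }.
Arguments sfun {X Y} f {n} x : rename.

Lemma smap_eq (X Y : sSet) (f g : smap X Y) :
  (forall n (x : X n), f n x = g n x) -> f = g.
Proof.
case: f => f fP; case: g => g gP /= efg.
have e : f = g.
  apply: functional_extensionality_dep => n.
  by apply: functional_extensionality_dep.
by subst g; congr SMap; apply: Prop_irrelevance.
Qed.

Definition sid (X : sSet) : smap X X.
Proof. by refine (@SMap X X (fun _ x => x) _). Defined.
Arguments sid {X}.

Definition scomp (X Y Z : sSet) (g : smap Y Z) (f : smap X Y) : smap X Z.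
Proof.
by refine (@SMap X Z (fun n x => g n (f n x)) _) => m n a x; rewrite !sfunP.
Defined.

Definition prodS (X Y : sSet) : sSet.
Proof.
refine (@SSet (fun n => X n * Y n)%type (fun m n a x => (act a x.1, act a x.2)) _ _).
- by move=> n [x y]; rewrite !act_id.
- by move=> *; rewrite !act_comp.
Defined.

Definition sfst (X Y : sSet) : smap (prodS X Y) X.
Proof. by refine (@SMap (prodS X Y) X (fun n x => x.1) _). Defined.

Definition ssnd (X Y : sSet) : smap (prodS X Y) Y.
Proof. by refine (@SMap (prodS X Y) Y (fun n x => x.2) _). Defined.

Definition spair (W X Y : sSet) (f : smap W X) (g : smap W Y) : smap W (prodS X Y).
Proof.
refine (@SMap W (prodS X Y) (fun n x => (f n x, g n x)) _).
by move=> m n a x; rewrite !sfunP.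
Defined.

Definition sprod (X Y X' Y' : sSet) (f : smap X X') (g : smap Y Y') :
  smap (prodS X Y) (prodS X' Y') :=
  spair (scomp f (@sfst X Y)) (scomp g (@ssnd X Y)).

Definition sassoc (X Y Z : sSet) : smap (prodS (prodS X Y) Z) (prodS X (prodS Y Z)) :=
  spair (scomp (@sfst X Y) (@sfst _ Z))
        (spair (scomp (@ssnd X Y) (@sfst _ Z)) (@ssnd _ Z)).

Definition Delta (n : nat) : sSet.
Proof.
refine (@SSet (fun m => delta m n) (fun m p a b => delta_comp b a) _ _).
- by move=> m b; apply: delta_eq.
- by move=> *; apply: delta_eq.
Defined.

Definition Delta_map m n (a : delta m n) : smap (Delta m) (Delta n).
Proof.
by refine (@SMap (Delta m) (Delta n) (fun _ b => delta_comp a b) _) => *; apply: delta_eq.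
Defined.

(* The horn omits the nondegenerate top simplex and the [k]-th face: its simplices
   are the maps missing some vertex other than [k]. *)
Definition horn n (k : 'I_n.+1) : sSet.
Proof.
refine (@SSet (fun m => {a : delta m n | exists2 i, i <> k & forall j, a j <> i})
  (fun m p b a => exist _ (delta_comp (proj1_sig a) b) _) _ _).
- by move=> m [a aP]; apply: eq_exist; apply: delta_eq.
- by move=> *; apply: eq_exist; apply: delta_eq.
Unshelve.
by case: a => a [i ik ai]; exists i => // j; apply: ai.
Defined.

Definition horn_incl n (k : 'I_n.+1) : smap (horn k) (Delta n).
Proof. by refine (@SMap (horn k) (Delta n) (fun _ a => proj1_sig a) _). Defined.

Definition is_quasicategory (X : sSet) :=
  forall n (k : 'I_n.+1), (0 < k < n)%N ->
  forall f : smap (horn k) X, exists g : smap (Delta n) X, scomp g (horn_incl k) = f.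

Record quasicategory := Quasicategory {
  qsset :> sSet;
  qcatP : is_quasicategory qsset }.

(* The internal hom B^A. *)
Definition expS (A B : sSet) : sSet.
Proof.
refine (@SSet (fun n => smap (prodS A (Delta n)) B)
  (fun m n a f => scomp f (sprod sid (Delta_map a))) _ _).
- move=> n f; apply: smap_eq => m [x b] /=; congr (f m (_, _)); exact: delta_eq.
- move=> m n p a b f; apply: smap_eq => q [x c] /=; congr (f q (_, _)); exact: delta_eq.
Defined.

(* Q^w : Q^B -> Q^A *)
Definition exp_pre (A B Q : sSet) (w : smap A B) : smap (expS B Q) (expS A Q).
Proof.
refine (@SMap (expS B Q) (expS A Q) (fun n f => scomp f (sprod w sid)) _).
by move=> m n a f; apply: smap_eq.
Defined.

(* Composition (g, f) |-> (a, t) |-> g (f (a, t), t), in every degree. *)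
Definition exp_comp (A B C : sSet) : smap (prodS (expS B C) (expS A B)) (expS A C).
Proof.
refine (@SMap (prodS (expS B C) (expS A B)) (expS A C)
  (fun n gf => scomp gf.1 (spair gf.2 (@ssnd A (Delta n)))) _).
by move=> m n a [g f]; apply: smap_eq.
Defined.

(* The vertex of B^A corresponding to a map A -> B under A x Delta^0 = A. *)
Definition vertex (A B : sSet) (f : smap A B) : expS A B 0 := scomp f (@sfst A (Delta 0)).

Definition cst m n (i : 'I_n.+1) : delta m n :=
  @mk_delta m n (fun=> i) (fun _ _ _ => leqnn i).

Definition seg_fun n (i j : 'I_n.+1) (t : 'I_2) := if t == ord0 then i else j.

Lemma seg_subproof n (i j : 'I_n.+1) : (i <= j)%N ->
  forall s t : 'I_2, (s <= t)%N -> (seg_fun i j s <= seg_fun i j t)%N.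
Proof. by move=> ij [[|[|s]] //= sP] [[|[|t]] //= tP]. Qed.

(* The map [1] -> [n] with image the edge i <= j. *)
Definition seg n (i j : 'I_n.+1) (ij : (i <= j)%N) : delta 1 n :=
  mk_delta (seg_subproof ij).

Section HomotopyCategory.
Variable X : sSet.

Definition edge (x y : X 0) :=
  {e : X 1 | act (cst 0 ord0) e = x /\ act (cst 0 ord_max) e = y}.

Inductive path : X 0 -> X 0 -> Type :=
| pnil x : path x x
| pcons x y z : edge x y -> path y z -> path x z.

Fixpoint pcat x y z (p : path x y) : path y z -> path x z :=
  match p in path x y return path y z -> path x z with
  | pnil _ => id
  | pcons _ _ _ e p' => fun q => pcons e (pcat p' q)
  end.

Definition single x y (e : edge x y) : path x y := pcons e (pnil y).

Lemma degen_subproof (x : X 0) :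
  act (cst 0 ord0) (act (cst 1 ord0) x) = x
  /\ act (cst 0 ord_max) (act (cst 1 ord0) x) = x.
Proof.
by split; rewrite -act_comp -[RHS]act_id; congr act; apply: delta_eq => i;
   rewrite [RHS]ord1.
Qed.

Definition degen (x : X 0) : edge x x := exist _ (act (cst 1 ord0) x) (degen_subproof x).

Definition vtx1 : 'I_3 := @Ordinal 3 1 isT.
Definition d01 : delta 1 2 := @seg 2 ord0 vtx1 isT.
Definition d12 : delta 1 2 := @seg 2 vtx1 ord_max isT.
Definition d02 : delta 1 2 := @seg 2 ord0 ord_max isT.

(* The congruence on paths generated by [degen x ~ nil] and, for every 2-simplex,
   [d01 ; d12 ~ d02]. *)
Inductive homotopic : forall x y, path x y -> path x y -> Prop :=
| htp_refl x y (p : path x y) : homotopic p p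
| htp_sym x y (p q : path x y) : homotopic p q -> homotopic q p
| htp_trans x y (p q r : path x y) : homotopic p q -> homotopic q r -> homotopic p r
| htp_cat x y z (p p' : path x y) (q q' : path y z) :
    homotopic p p' -> homotopic q q' -> homotopic (pcat p q) (pcat p' q')
| htp_degen x : homotopic (single (degen x)) (pnil x)
| htp_triangle x y z (e : edge x y) (f : edge y z) (g : edge x z) (s : X 2) :
    act d01 s = proj1_sig e -> act d12 s = proj1_sig f -> act d02 s = proj1_sig g ->
    homotopic (pcons e (single f)) (single g).

HB.instance Definition _ x y := gen_eqMixin (path x y).
HB.instance Definition _ x y := gen_choiceMixin (path x y).

Definition homotopicb x y (p q : path x y) : bool := `[< homotopic p q >].

Lemma homotopicb_class x y : equiv_class_of (@homotopicb x y).
Proof.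
split=> [p|p q|q p r].
- by apply/asboolP; apply: htp_refl.
- by apply/asboolP/asboolP => /htp_sym.
- by move=> /asboolP pq /asboolP qr; apply/asboolP; apply: htp_trans qr.
Qed.

Canonical homotopicb_equiv x y := EquivRelPack (homotopicb_class x y).

Local Notation hhom x y := {eq_quot @homotopicb x y}.
Definition hclass x y (p : path x y) : hhom x y := \pi_(hhom x y) p.

Lemma hclassP x y (p q : path x y) : hclass p = hclass q <-> homotopic p q.
Proof. by split=> [/eqquotP/asboolP|pq]; last apply/eqquotP/asboolP. Qed.

Lemma hclassW x y (P : hhom x y -> Prop) : (forall p, P (hclass p)) -> forall a, P a.
Proof. exact: quotW. Qed.

Lemma hrepr x y (p : path x y) : homotopic (repr (hclass p)) p.
Proof. by apply/hclassP; apply: reprK. Qed.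

Definition hcomp x y z (b : hhom y z) (a : hhom x y) : hhom x z :=
  hclass (pcat (repr a) (repr b)).

Lemma hcompE x y z (p : path x y) (q : path y z) :
  hcomp (hclass q) (hclass p) = hclass (pcat p q).
Proof. by apply/hclassP; apply: htp_cat; apply: hrepr. Qed.

Lemma pcatp0 x y (p : path x y) : pcat p (pnil y) = p.
Proof. by elim: p => //= a b c e p ->. Qed.

Lemma pcatA x y z t (p : path x y) (q : path y z) (r : path z t) :
  pcat (pcat p q) r = pcat p (pcat q r).
Proof. by elim: p q => //= a b c e p IH q; rewrite IH. Qed.

(* hX: the category generated by the graph of 0- and 1-simplices, subject to the
   relations given by degenerate edges and 2-simplices; [h_left_adjoint] below shows
   that this is the value at X of the left adjoint to the nerve. *)
Definition hCat : category.
Proof.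
refine (@Category (X 0) (fun x y => hhom x y) (fun x => hclass (pnil x)) hcomp _ _ _).
- by move=> x y; apply: hclassW => p; rewrite hcompE pcatp0.
- by move=> x y; apply: hclassW => p; rewrite hcompE.
- move=> x y z t; apply: hclassW => p; apply: hclassW => q; apply: hclassW => r.
  by rewrite !hcompE pcatA.
Defined.

Definition hedge x y (e : edge x y) : @hom hCat x y := hclass (single e).

Section Lift.
Variables (C : category) (o : X 0 -> C).
Variable m : forall x y, edge x y -> hom (o x) (o y).
Hypothesis m_degen : forall x, m (degen x) = idm (o x).
Hypothesis m_triangle : forall x y z (e : edge x y) (f : edge y z) (g : edge x z) (s : X 2),
  act d01 s = proj1_sig e -> act d12 s = proj1_sig f -> act d02 s = proj1_sig g ->
  comp (m f) (m e) = m g.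

Fixpoint pfold x y (p : path x y) : hom (o x) (o y) :=
  match p in path x y return hom (o x) (o y) with
  | pnil x => idm (o x)
  | pcons _ _ _ e q => comp (pfold q) (m e)
  end.

Lemma pfold_cat x y z (p : path x y) (q : path y z) :
  pfold (pcat p q) = comp (pfold q) (pfold p).
Proof. by elim: p q => /= [a q|a b c e p IH q]; rewrite ?compm1// IH compA. Qed.

Lemma pfold_homotopic x y (p q : path x y) : homotopic p q -> pfold p = pfold q.
Proof.
elim=> //= {x y p q}.
- by move=> x y p q r _ -> _ ->.
- by move=> x y z p p' q q' _ e _ f; rewrite !pfold_cat e f.
- by move=> x; rewrite comp1m.
- by move=> x y z e f g s e1 e2 e3; rewrite !comp1m; apply: m_triangle e1 e2 e3.
Qed.

Definition hlift : functor hCat C.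
Proof.
refine (@Functor hCat C o (fun x y a => pfold (repr a)) _ _).
- by move=> x; rewrite (pfold_homotopic (hrepr _)).
- move=> x y z; apply: hclassW => q; apply: hclassW => p.
  by rewrite /= hcompE !(pfold_homotopic (hrepr _)) pfold_cat.
Defined.

Lemma hlift_edge x y (e : edge x y) : fhom hlift (hedge e) = m e.
Proof. by rewrite /= (pfold_homotopic (hrepr _)) /= comp1m. Qed.

End Lift.

Lemma hedge_degen x : hedge (degen x) = @idm hCat x.
Proof. by apply/hclassP; apply: htp_degen. Qed.

Lemma hedge_triangle x y z (e : edge x y) (f : edge y z) (g : edge x z) (s : X 2) :
  act d01 s = proj1_sig e -> act d12 s = proj1_sig f -> act d02 s = proj1_sig g ->
  comp (hedge f) (hedge e) = hedge g.
Proof.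
by move=> e1 e2 e3; rewrite /= hcompE; apply/hclassP; apply: htp_triangle e1 e2 e3.
Qed.

Lemma hclass_cons x y z (e : edge x y) (p : path y z) :
  hclass (pcons e p) = @comp hCat _ _ _ (hclass p) (hedge e).
Proof. by rewrite /= hcompE. Qed.

Lemma hfunctor_eq (C : category) (F G : functor hCat C) :
  (forall x y (e : edge x y), arr (fhom F (hedge e)) = arr (fhom G (hedge e))) -> F = G.
Proof.
move=> eFG; apply: functor_eq => x y; apply: hclassW; elim=> {x y} [x|x y z e p IH].
  rewrite -[hclass (pnil x)]/(@idm hCat x) -hedge_degen; exact: eFG.
by rewrite hclass_cons !fhom_comp; apply: arr_comp.
Qed.

Lemma edge_eq x y (e f : edge x y) : proj1_sig e = proj1_sig f -> e = f.
Proof. by case: e f => [e eP] [f fP] /= ef; apply: eq_exist. Qed.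

Lemma arr_hedge x y x' y' (e : edge x y) (f : edge x' y') :
  proj1_sig e = proj1_sig f -> arr (hedge e) = arr (hedge f).
Proof.
move=> ef; have ex : x = x'.
  by rewrite -(proj1 (proj2_sig e)) -(proj1 (proj2_sig f)) ef.
have ey : y = y' by rewrite -(proj2 (proj2_sig e)) -(proj2 (proj2_sig f)) ef.
by subst x' y'; rewrite (edge_eq ef).
Qed.

Lemma arr_hedge_degen x y z (e : edge x y) :
  proj1_sig e = proj1_sig (degen z) -> arr (hedge e) = arr (@idm hCat z).
Proof. by rewrite -hedge_degen; apply: arr_hedge. Qed.

End HomotopyCategory.

Section HMap.
Variables (X Y : sSet) (f : smap X Y).

Lemma edge_map_subproof (x y : X 0) (e : edge x y) :
  act (cst 0 ord0) (f 1 (proj1_sig e)) = f 0 x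
  /\ act (cst 0 ord_max) (f 1 (proj1_sig e)) = f 0 y.
Proof. by case: e => e /= [ex ey]; rewrite -!sfunP ex ey. Qed.

Definition edge_map (x y : X 0) (e : edge x y) : edge (f 0 x) (f 0 y) :=
  exist _ (f 1 (proj1_sig e)) (edge_map_subproof e).

Lemma hmap_degen (x : X 0) : hedge (edge_map (degen x)) = @idm (hCat Y) (f 0 x).
Proof.
by rewrite -hedge_degen; congr hedge; apply: edge_eq; rewrite /= sfunP.
Qed.

Lemma hmap_triangle (x y z : X 0) (e : edge x y) (g : edge y z) (k : edge x z) (s : X 2) :
  act d01 s = proj1_sig e -> act d12 s = proj1_sig g -> act d02 s = proj1_sig k ->
  comp (hedge (edge_map g)) (hedge (edge_map e)) = hedge (edge_map k).
Proof.
move=> e1 e2 e3; apply: (@hedge_triangle Y _ _ _ _ _ _ (f 2 s)); rewrite -sfunP /=.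
- by rewrite e1.
- by rewrite e2.
- by rewrite e3.
Qed.

Definition hmap : functor (hCat X) (hCat Y) := hlift hmap_degen hmap_triangle.

Lemma hmap_edge (x y : X 0) (e : edge x y) : fhom hmap (hedge e) = hedge (edge_map e).
Proof. exact: hlift_edge. Qed.

End HMap.

Lemma hmap_id (X : sSet) : hmap (@sid X) = fid.
Proof.
apply: hfunctor_eq => x y e; rewrite hmap_edge.
exact: (@arr_hedge X _ _ _ _ (edge_map sid e) e erefl).
Qed.

Lemma hmap_comp (X Y Z : sSet) (g : smap Y Z) (f : smap X Y) :
  hmap (scomp g f) = fcomp (hmap g) (hmap f).
Proof.
apply: hfunctor_eq => x y e.
rewrite [RHS]/(arr (fhom (hmap g) (fhom (hmap f) (hedge e)))) !hmap_edge.
exact: (@arr_hedge Z _ _ _ _ (edge_map (scomp g f) e) (edge_map g (edge_map f e)) erefl).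
Qed.

Definition ord_cat (n : nat) : category.
Proof.
by refine (@Category 'I_n.+1 (fun i j => (i <= j)%N) (fun i => leqnn i)
  (fun _ _ _ jk ij => leq_trans ij jk) _ _ _) => *; apply: Prop_irrelevance.
Defined.

Lemma ord_hom_eq n (i j : ord_cat n) (a b : hom i j) : a = b.
Proof. exact: (@Prop_irrelevance (is_true (i <= j)%N) a b). Qed.

Definition ord_functor m n (a : delta m n) : functor (ord_cat m) (ord_cat n).
Proof.
by refine (@Functor (ord_cat m) (ord_cat n) a (fun i j => @delta_le _ _ a i j) _ _) => *;
   apply: ord_hom_eq.
Defined.

Lemma arr_ord n (i j i' j' : ord_cat n) (a : hom i j) (b : hom i' j') :
  i = i' -> j = j' -> arr a = arr b.
Proof.
move=> ei ej; subst i' j'; congr arr; exact: ord_hom_eq.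
Qed.

Definition nerve (C : category) : sSet.
Proof.
refine (@SSet (fun n => functor (ord_cat n) C)
  (fun m n a F => fcomp F (ord_functor a)) _ _).
- move=> n F; apply: functor_eq => i j ij; apply: (@arr_fhom _ _ F); exact: arr_ord.
- move=> m n p a b F; apply: functor_eq => i j ij; apply: (@arr_fhom _ _ F).
  exact: arr_ord.
Defined.

Definition nerve_map (C D : category) (F : functor C D) : smap (nerve C) (nerve D).
Proof.
refine (@SMap (nerve C) (nerve D) (fun n s => fcomp F s) _).
by move=> m n a s; apply: functor_eq.
Defined.

Section Unit.
Variable X : sSet.

Lemma seg_edge_subproof n (x : X n) (i j : 'I_n.+1) (ij : (i <= j)%N) :
  act (cst 0 ord0) (act (seg ij) x) = act (cst 0 i) x
  /\ act (cst 0 ord_max) (act (seg ij) x) = act (cst 0 j) x.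
Proof. by rewrite -!act_comp; split; congr act; apply: delta_eq. Qed.

Definition seg_edge n (x : X n) (i j : 'I_n.+1) (ij : (i <= j)%N) :
    edge (act (cst 0 i) x) (act (cst 0 j) x) :=
  exist _ (act (seg ij) x) (seg_edge_subproof x ij).

Definition hunit_simplex n (x : X n) : functor (ord_cat n) (hCat X).
Proof.
refine (@Functor (ord_cat n) (hCat X) (fun i => act (cst 0 i) x)
  (fun i j ij => hedge (seg_edge x ij)) _ _).
- move=> i; rewrite -hedge_degen; congr hedge; apply: edge_eq => /=.
  by rewrite -act_comp; congr act; apply: delta_eq => t /=; rewrite /seg_fun if_same.
- move=> i j k jk ij; apply/esym.
  have sP (s t : 'I_3) : (s <= t)%N ->
      ((if s == ord0 then i else if s == vtx1 then j else k)
       <= (if t == ord0 then i else if t == vtx1 then j else k))%N.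
    case: s t => [[|[|[|s]]] //= sP] [[|[|[|t]]] //= tP] _ //.
    exact: leq_trans ij jk.
  apply: (@hedge_triangle X _ _ _ _ _ _ (act (mk_delta sP) x));
    by rewrite -act_comp; congr act; apply: delta_eq => -[[|[|t]] tP].
Defined.

Definition hunit : smap X (nerve (hCat X)).
Proof.
refine (@SMap X (nerve (hCat X)) hunit_simplex _).
move=> m n a x; apply: functor_eq => i j ij; apply: arr_hedge => /=.
by rewrite -act_comp; congr act; apply: delta_eq => t /=; rewrite /seg_fun; case: ifP.
Defined.

End Unit.

Lemma hunit_natural (X Y : sSet) (f : smap X Y) :
  scomp (@hunit Y) f = scomp (nerve_map (hmap f)) (@hunit X).
Proof.
apply: smap_eq => n x; apply: functor_eq => i j ij.
rewrite [RHS]/(arr (fhom (hmap f) (hedge (seg_edge x ij)))) hmap_edge.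
apply: (@arr_hedge Y _ _ _ _ (seg_edge (f n x) ij) (edge_map f (seg_edge x ij))).
by rewrite /= sfunP.
Qed.

Definition hom_cast (C : category) (x y x' y' : C) (ex : x = x') (ey : y = y')
    (f : hom x y) : hom x' y' :=
  eq_rect y (hom x') (eq_rect x (fun z => hom z y) f x' ex) y' ey.

Lemma arr_cast (C : category) (x y x' y' : C) (ex : x = x') (ey : y = y') (f : hom x y) :
  arr (hom_cast ex ey f) = arr f.
Proof. by subst x' y'. Qed.

Section Adjunct.
Variables (X : sSet) (C : category) (g : smap X (nerve C)).

Let g_act m n (a : delta m n) (x : X n) (i j : ord_cat m) (ij : hom i j) :
  arr (fhom (g m (act a x)) ij) = arr (fhom (g n x) (@delta_le _ _ a i j ij)).
Proof. by rewrite sfunP. Qed.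

Definition arrow01 : @hom (ord_cat 1) ord0 ord_max := isT.

Lemma adjunct_src (x y : X 0) (e : edge x y) : g 1 (proj1_sig e) ord0 = g 0 x ord0.
Proof. by case: e => e /= [<- _]; rewrite sfunP. Qed.

Lemma adjunct_tgt (x y : X 0) (e : edge x y) : g 1 (proj1_sig e) ord_max = g 0 y ord0.
Proof. by case: e => e /= [_ <-]; rewrite sfunP. Qed.

Definition adjunct_edge (x y : X 0) (e : edge x y) : hom (g 0 x ord0) (g 0 y ord0) :=
  hom_cast (adjunct_src e) (adjunct_tgt e) (fhom (g 1 (proj1_sig e)) arrow01).

Lemma arr_adjunct_edge (x y : X 0) (e : edge x y) :
  arr (adjunct_edge e) = arr (fhom (g 1 (proj1_sig e)) arrow01).
Proof. exact: arr_cast. Qed.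

Lemma adjunct_degen (x : X 0) : adjunct_edge (degen x) = idm (g 0 x ord0).
Proof.
by apply: arr_inj; rewrite arr_cast g_act -fhom_id; apply: arr_fhom; apply: arr_ord.
Qed.

Lemma adjunct_triangle (x y z : X 0) (e : edge x y) (f : edge y z) (k : edge x z) (s : X 2) :
  act d01 s = proj1_sig e -> act d12 s = proj1_sig f -> act d02 s = proj1_sig k ->
  comp (adjunct_edge f) (adjunct_edge e) = adjunct_edge k.
Proof.
move=> e1 e2 e3; apply: arr_inj.
rewrite [RHS]arr_cast -e3 g_act.
have -> : @delta_le _ _ d02 _ _ arrow01
    = comp (@delta_le _ _ d12 _ _ arrow01 : @hom (ord_cat 2) vtx1 ord_max)
           (@delta_le _ _ d01 _ _ arrow01 : @hom (ord_cat 2) ord0 vtx1).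
  exact: ord_hom_eq.
rewrite fhom_comp; apply: arr_comp; rewrite arr_cast.
- by rewrite -e1 g_act.
- by rewrite -e2 g_act.
Qed.

Definition adjunct : functor (hCat X) C := hlift adjunct_degen adjunct_triangle.

Lemma adjunct_hedge (x y : X 0) (e : edge x y) :
  arr (fhom adjunct (hedge e)) = arr (fhom (g 1 (proj1_sig e)) arrow01).
Proof.
rewrite (hlift_edge adjunct_degen adjunct_triangle); exact: arr_adjunct_edge.
Qed.

End Adjunct.

(* [hunit] is a universal arrow from X to the nerve, so h is left adjoint to it. *)
Theorem h_left_adjoint (X : sSet) (C : category) (g : smap X (nerve C)) :
  exists! F : functor (hCat X) C, scomp (nerve_map F) (@hunit X) = g.
Proof.
exists (adjunct g); split=> [|F Fg].
  apply: smap_eq => n x; apply: functor_eq => i j ij.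
  apply: (etrans (adjunct_hedge g (seg_edge x ij))).
  have -> : g 1 (proj1_sig (seg_edge x ij)) = fcomp (g n x) (ord_functor (seg ij)).
    exact: sfunP.
  by apply: (@arr_fhom _ _ (g n x)); exact: arr_ord.
apply: hfunctor_eq => x y e; apply: (etrans (adjunct_hedge g e)); rewrite -Fg.
apply: (@arr_fhom _ _ F).
apply: (@arr_hedge X _ _ _ _ (seg_edge (proj1_sig e) arrow01) e) => /=.
rewrite -[RHS]act_id; congr act; apply: delta_eq => -[[|[|t]] //= tP];
  exact: val_inj.
Qed.

Section HPair.
Variables X Y : sSet.
Notation XY := (prodS X Y).

Lemma pedge_subproof (x x' : X 0) (y y' : Y 0) (e : edge x x') (f : edge y y') :
  act (cst 0 ord0) ((proj1_sig e, proj1_sig f) : XY 1) = (x, y)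
  /\ act (cst 0 ord_max) ((proj1_sig e, proj1_sig f) : XY 1) = (x', y').
Proof. by case: e f => e /= [<- <-] [f /= [<- <-]]. Qed.

Definition pedge (x x' : X 0) (y y' : Y 0) (e : edge x x') (f : edge y y') :
    @edge XY (x, y) (x', y') :=
  exist _ (proj1_sig e, proj1_sig f) (pedge_subproof e f).

Lemma act_cst (Z : sSet) m n p (a : delta m n) (i : 'I_p.+1) (z : Z p) :
  act a (act (cst n i) z) = act (cst m i) z.
Proof. by rewrite -act_comp; congr act; apply: delta_eq. Qed.

Lemma insl_degen (y : Y 0) (x : X 0) :
  hedge (pedge (degen x) (degen y)) = @idm (hCat XY) (x, y).
Proof. by rewrite -hedge_degen; congr hedge; apply: edge_eq. Qed.

Lemma insl_triangle (y : Y 0) (x1 x2 x3 : X 0) (e : edge x1 x2) (f : edge x2 x3)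
    (g : edge x1 x3) (s : X 2) :
  act d01 s = proj1_sig e -> act d12 s = proj1_sig f -> act d02 s = proj1_sig g ->
  comp (hedge (pedge f (degen y))) (hedge (pedge e (degen y))) = hedge (pedge g (degen y)).
Proof.
move=> e1 e2 e3.
by apply: (@hedge_triangle XY _ _ _ _ _ _ (s, act (cst 2 ord0) y));
  rewrite /= act_cst ?e1 ?e2 ?e3.
Qed.

Lemma insr_triangle (x : X 0) (y1 y2 y3 : Y 0) (e : edge y1 y2) (f : edge y2 y3)
    (g : edge y1 y3) (s : Y 2) :
  act d01 s = proj1_sig e -> act d12 s = proj1_sig f -> act d02 s = proj1_sig g ->
  comp (hedge (pedge (degen x) f)) (hedge (pedge (degen x) e)) = hedge (pedge (degen x) g).
Proof.
move=> e1 e2 e3.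
by apply: (@hedge_triangle XY _ _ _ _ _ _ (act (cst 2 ord0) x, s));
  rewrite /= act_cst ?e1 ?e2 ?e3.
Qed.

Definition insl (y : Y 0) : functor (hCat X) (hCat XY) :=
  @hlift X (hCat XY) (fun x => (x, y)) (fun _ _ e => hedge (pedge e (degen y)))
    (insl_degen y) (insl_triangle y).

Definition insr (x : X 0) : functor (hCat Y) (hCat XY) :=
  @hlift Y (hCat XY) (fun y => (x, y)) (fun _ _ e => hedge (pedge (degen x) e))
    (fun y => insl_degen y x) (insr_triangle x).

Lemma insl_edge (y : Y 0) (x x' : X 0) (e : edge x x') :
  fhom (insl y) (hedge e) = hedge (pedge e (degen y)).
Proof. exact: hlift_edge. Qed.

Lemma insr_edge (x : X 0) (y y' : Y 0) (e : edge y y') :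
  fhom (insr x) (hedge e) = hedge (pedge (degen x) e).
Proof. exact: hlift_edge. Qed.

(* The maps [2] -> [1] with values 0,0,1 and 0,1,1. *)
Definition step (k : nat) (t : 'I_3) : 'I_2 := if (t <= k)%N then ord0 else ord_max.

Lemma step_subproof k (s t : 'I_3) : (s <= t)%N -> (step k s <= step k t)%N.
Proof.
by rewrite /step => st; case: (leqP t k) => [/(leq_trans st) ->|_] //; case: ifP.
Qed.

Definition codeg (k : nat) : delta 2 1 := mk_delta (@step_subproof k).

Lemma codegP (Z : sSet) (z z' : Z 0) (e : edge z z') :
  [/\ act d01 (act (codeg 1) (proj1_sig e)) = proj1_sig (degen z),
      act d12 (act (codeg 1) (proj1_sig e)) = proj1_sig e,
      act d02 (act (codeg 1) (proj1_sig e)) = proj1_sig e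
    & [/\ act d01 (act (codeg 0) (proj1_sig e)) = proj1_sig e,
          act d12 (act (codeg 0) (proj1_sig e)) = proj1_sig (degen z')
        & act d02 (act (codeg 0) (proj1_sig e)) = proj1_sig e]].
Proof.
case: e => e /= [<- <-]; split; last split; rewrite -!act_comp.
all: try by congr act; apply: delta_eq => -[[|[|t]] tP].
all: by rewrite -[RHS]act_id; congr act; apply: delta_eq => -[[|[|t]] //= tP]; exact: val_inj.
Qed.

Lemma pedge_lr (x x' : X 0) (y y' : Y 0) (e : edge x x') (f : edge y y') :
  comp (fhom (insl y') (hedge e)) (fhom (insr x) (hedge f)) = hedge (pedge e f).
Proof.
rewrite insl_edge insr_edge.
have [a1 a2 a3 [a4 a5 a6]] := codegP e; have [b1 b2 b3 [b4 b5 b6]] := codegP f.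
by apply: (@hedge_triangle XY _ _ _ _ _ _
    (act (codeg 1) (proj1_sig e), act (codeg 0) (proj1_sig f))); congr pair.
Qed.

Lemma pedge_rl (x x' : X 0) (y y' : Y 0) (e : edge x x') (f : edge y y') :
  comp (fhom (insr x') (hedge f)) (fhom (insl y) (hedge e)) = hedge (pedge e f).
Proof.
rewrite insl_edge insr_edge.
have [a1 a2 a3 [a4 a5 a6]] := codegP e; have [b1 b2 b3 [b4 b5 b6]] := codegP f.
by apply: (@hedge_triangle XY _ _ _ _ _ _
    (act (codeg 0) (proj1_sig e), act (codeg 1) (proj1_sig f))); congr pair.
Qed.

Lemma hcomm (x x' : hCat X) (y y' : hCat Y) (p : hom x x') (q : hom y y') :
  comp (fhom (insl y') p) (fhom (insr x) q) = comp (fhom (insr x') q) (fhom (insl y) p).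
Proof.
move: p q; apply: hclassW => p; apply: hclassW => q.
elim: p => {x x'} [x|x x' x'' e p IH].
  by rewrite -[hclass (pnil x)]/(@idm (hCat X) x) !fhom_id; exact: etrans (comp1m _) (esym (compm1 _)).
rewrite hclass_cons !fhom_comp compA -IH -!compA; congr comp.
elim: q {IH p x''} => {y y'} [y|y y' y'' f q IH].
  by rewrite -[hclass (pnil y)]/(@idm (hCat Y) y) !fhom_id; exact: etrans (compm1 _) (esym (comp1m _)).
by rewrite hclass_cons !fhom_comp compA IH -!compA pedge_lr pedge_rl.
Qed.

Definition hpair : functor (prodC (hCat X) (hCat Y)) (hCat XY).
Proof.
refine (@Functor (prodC (hCat X) (hCat Y)) (hCat XY) (fun z => (z.1, z.2))
  (fun z z' f => comp (fhom (insl z'.2) f.1) (fhom (insr z.1) f.2)) _ _).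
- by move=> z; rewrite !fhom_id; exact: comp1m.
- move=> z z' z'' g f; rewrite !fhom_comp -!compA; congr comp.
  by rewrite !compA; congr comp; exact: hcomm.
Defined.

Lemma hfst_insl (y : Y 0) : fcomp (hmap (@sfst X Y)) (insl y) = fid.
Proof.
apply: hfunctor_eq => x x' e.
rewrite [LHS]/(arr (fhom (hmap _) (fhom (insl y) _))) insl_edge hmap_edge.
exact: (@arr_hedge X _ _ _ _ (edge_map (@sfst X Y) (pedge e (degen y))) e erefl).
Qed.

Lemma hfst_insr (x : X 0) : fcomp (hmap (@sfst X Y)) (insr x) = @fconst _ (hCat X) x.
Proof.
apply: hfunctor_eq => y y' e.
rewrite [LHS]/(arr (fhom (hmap _) (fhom (insr x) _))) insr_edge hmap_edge.
exact: (@arr_hedge_degen X _ _ x (edge_map (@sfst X Y) (pedge (degen x) e)) erefl).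
Qed.

Lemma hsnd_insr (x : X 0) : fcomp (hmap (@ssnd X Y)) (insr x) = fid.
Proof.
apply: hfunctor_eq => y y' e.
rewrite [LHS]/(arr (fhom (hmap _) (fhom (insr x) _))) insr_edge hmap_edge.
exact: (@arr_hedge Y _ _ _ _ (edge_map (@ssnd X Y) (pedge (degen x) e)) e erefl).
Qed.

Lemma hsnd_insl (y : Y 0) : fcomp (hmap (@ssnd X Y)) (insl y) = @fconst _ (hCat Y) y.
Proof.
apply: hfunctor_eq => x x' e.
rewrite [LHS]/(arr (fhom (hmap _) (fhom (insl y) _))) insl_edge hmap_edge.
exact: (@arr_hedge_degen Y _ _ y (edge_map (@ssnd X Y) (pedge e (degen y))) erefl).
Qed.

Lemma arr_functor (C D : category) (F G : functor C D) (x y : C) (f : hom x y) :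
  F = G -> arr (fhom F f) = arr (fhom G f).
Proof. by move=> ->. Qed.

Lemma hfst_hpair : fcomp (hmap (@sfst X Y)) hpair = @ffst (hCat X) (hCat Y).
Proof.
apply: functor_eq => -[x y] [x' y'] [p q].
rewrite [LHS]/(arr (fhom (hmap _) (comp (fhom (insl y') p) (fhom (insr x) q)))) fhom_comp.
rewrite [RHS]/(arr p) -[p in RHS]compm1; apply: arr_comp.
- exact: (arr_functor q (hfst_insr x)).
- exact: (arr_functor p (hfst_insl y')).
Qed.

Lemma hsnd_hpair : fcomp (hmap (@ssnd X Y)) hpair = @fsnd (hCat X) (hCat Y).
Proof.
apply: functor_eq => -[x y] [x' y'] [p q].
rewrite [LHS]/(arr (fhom (hmap _) (comp (fhom (insl y') p) (fhom (insr x) q)))) fhom_comp.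
rewrite [RHS]/(arr q) -[q in RHS]comp1m; apply: arr_comp.
- exact: (arr_functor q (hsnd_insr x)).
- exact: (arr_functor p (hsnd_insl y')).
Qed.

Lemma hpairK : fcomp hpair (fpair (hmap (@sfst X Y)) (hmap (@ssnd X Y))) = fid.
Proof.
apply: hfunctor_eq => -[x y] [x' y'] e.
rewrite [LHS]/(arr (comp (fhom (insl y') (fhom (hmap (@sfst X Y)) (hedge e)))
                         (fhom (insr x) (fhom (hmap (@ssnd X Y)) (hedge e))))).
rewrite !hmap_edge pedge_lr; apply: (@arr_hedge XY _ _ _ _ _ e) => /=.
by case: (proj1_sig e).
Qed.

Lemma hprod_ext (C : category) (F G : functor C (hCat XY)) :
  fcomp (hmap (@sfst X Y)) F = fcomp (hmap (@sfst X Y)) G ->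
  fcomp (hmap (@ssnd X Y)) F = fcomp (hmap (@ssnd X Y)) G -> F = G.
Proof.
have key (H : functor C (hCat XY)) : H = fcomp hpair
    (fpair (fcomp (hmap (@sfst X Y)) H) (fcomp (hmap (@ssnd X Y)) H)).
  by rewrite -[LHS]fcomp1f -hpairK; apply: functor_eq.
by move=> e1 e2; rewrite (key F) e1 e2 -key.
Qed.

End HPair.

Lemma fst_fpair (B C D : category) (F : functor B C) (G : functor B D) :
  fcomp (@ffst C D) (fpair F G) = F.
Proof. exact: functor_eq. Qed.

Lemma snd_fpair (B C D : category) (F : functor B C) (G : functor B D) :
  fcomp (@fsnd C D) (fpair F G) = G.
Proof. exact: functor_eq. Qed.

Lemma fst_fprod (C D C' D' : category) (F : functor C C') (G : functor D D') :
  fcomp (@ffst C' D') (fprod F G) = fcomp F (@ffst C D).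
Proof. exact: fst_fpair. Qed.

Lemma snd_fprod (C D C' D' : category) (F : functor C C') (G : functor D D') :
  fcomp (@fsnd C' D') (fprod F G) = fcomp G (@fsnd C D).
Proof. exact: snd_fpair. Qed.

Lemma fprod_comp (C D C' D' C'' D'' : category) (F : functor C C') (G : functor D D')
    (F' : functor C' C'') (G' : functor D' D'') :
  fprod (fcomp F' F) (fcomp G' G) = fcomp (fprod F' G') (fprod F G).
Proof. exact: functor_eq. Qed.

Lemma fst_fassoc (C D E : category) :
  fcomp (@ffst C (prodC D E)) (@fassoc C D E) = fcomp (@ffst C D) (@ffst _ E).
Proof. exact: fst_fpair. Qed.

Lemma snd_fassoc (C D E : category) :
  fcomp (@fsnd C (prodC D E)) (@fassoc C D E)
  = fpair (fcomp (@fsnd C D) (@ffst _ E)) (@fsnd _ E).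
Proof. exact: snd_fpair. Qed.

Lemma hpair_natural (X Y X' Y' : sSet) (f : smap X X') (g : smap Y Y') :
  fcomp (@hpair X' Y') (fprod (hmap f) (hmap g)) = fcomp (hmap (sprod f g)) (@hpair X Y).
Proof.
have e1 : scomp (@sfst X' Y') (sprod f g) = scomp f (@sfst X Y) by exact: smap_eq.
have e2 : scomp (@ssnd X' Y') (sprod f g) = scomp g (@ssnd X Y) by exact: smap_eq.
apply: hprod_ext; rewrite !fcompA ?hfst_hpair ?hsnd_hpair -hmap_comp.
- by rewrite fst_fprod e1 hmap_comp -fcompA hfst_hpair.
- by rewrite snd_fprod e2 hmap_comp -fcompA hsnd_hpair.
Qed.

Lemma hpair_assoc (X Y Z : sSet) :
  fcomp (hmap (@sassoc X Y Z)) (fcomp (@hpair (prodS X Y) Z) (fprod (@hpair X Y) fid))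
  = fcomp (fcomp (@hpair X (prodS Y Z)) (fprod fid (@hpair Y Z)))
          (@fassoc (hCat X) (hCat Y) (hCat Z)).
Proof.
set L := fcomp (@hpair (prodS X Y) Z) _.
have e1 : fcomp (hmap (@sfst _ Z)) L = fcomp (@hpair X Y) (@ffst _ (hCat Z)).
  by rewrite /L fcompA hfst_hpair fst_fprod.
have e2 : fcomp (hmap (@ssnd _ Z)) L = @fsnd _ (hCat Z).
  by rewrite /L fcompA hsnd_hpair snd_fprod fcomp1f.
move: L e1 e2 => L e1 e2.
have s1 : scomp (@sfst X (prodS Y Z)) (@sassoc X Y Z) = scomp (@sfst X Y) (@sfst _ Z).
  exact: smap_eq.
have s2 : scomp (@sfst Y Z) (scomp (@ssnd X (prodS Y Z)) (@sassoc X Y Z))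
    = scomp (@ssnd X Y) (@sfst _ Z) by exact: smap_eq.
have s3 : scomp (@ssnd Y Z) (scomp (@ssnd X (prodS Y Z)) (@sassoc X Y Z)) = @ssnd _ Z.
  exact: smap_eq.
rewrite -[RHS]fcompA; apply: hprod_ext; rewrite [LHS]fcompA [RHS]fcompA -hmap_comp.
  rewrite s1 hmap_comp -[LHS]fcompA e1 [LHS]fcompA !hfst_hpair.
  by rewrite [RHS]fcompA fst_fprod fcomp1f fst_fassoc.
rewrite hsnd_hpair [RHS]fcompA snd_fprod -[RHS]fcompA snd_fassoc.
apply: hprod_ext; rewrite [LHS]fcompA [RHS]fcompA -hmap_comp.
  rewrite s2 hmap_comp -[LHS]fcompA e1 [LHS]fcompA hsnd_hpair hfst_hpair.
  by rewrite fst_fpair.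
by rewrite s3 e2 hsnd_hpair snd_fpair.
Qed.

Lemma hmap_hpair (X Y X' Y' Z : sSet) (C : category) (f : smap X X') (g : smap Y Y')
    (k : smap (prodS X' Y') Z) (P : functor C (prodC (hCat X) (hCat Y))) :
  fcomp (fcomp (hmap k) (@hpair X' Y')) (fcomp (fprod (hmap f) (hmap g)) P)
  = fcomp (hmap (scomp k (sprod f g))) (fcomp (@hpair X Y) P).
Proof.
rewrite -[LHS]fcompA [X in fcomp _ X = _]fcompA hpair_natural hmap_comp.
by rewrite -[X in fcomp _ X = _]fcompA [LHS]fcompA.
Qed.

Definition hom' (A B : sSet) : category := hCat (expS A B).

Definition hom'_comp (A B C : sSet) : functor (prodC (hom' B C) (hom' A B)) (hom' A C) :=
  fcomp (hmap (@exp_comp A B C)) (@hpair (expS B C) (expS A B)).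

Lemma hom'_compA (A B C D : sSet) :
  fcomp (hom'_comp A B D) (fprod (hom'_comp B C D) fid)
  = fcomp (fcomp (hom'_comp A C D) (fprod fid (hom'_comp A B C)))
          (@fassoc (hom' C D) (hom' B C) (hom' A B)).
Proof.
have eL : fprod (hom'_comp B C D) (@fid (hom' A B))
    = fcomp (fprod (hmap (@exp_comp B C D)) (hmap (@sid (expS A B))))
            (fprod (@hpair _ _) fid).
  by rewrite hmap_id -fprod_comp fcomp1f.
have eR : fprod (@fid (hom' C D)) (hom'_comp A B C)
    = fcomp (fprod (hmap (@sid (expS C D))) (hmap (@exp_comp A B C)))
            (fprod fid (@hpair _ _)).
  by rewrite hmap_id -fprod_comp fcomp1f.
have s1 : scomp (@exp_comp A B D) (sprod (@exp_comp B C D) sid)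
    = scomp (scomp (@exp_comp A C D) (sprod sid (@exp_comp A B C)))
            (@sassoc (expS C D) (expS B C) (expS A B)).
  by apply: smap_eq => n [[k g] f]; apply: smap_eq.
rewrite eL eR /hom'_comp !hmap_hpair s1 hmap_comp -[LHS]fcompA hpair_assoc.
exact: fcompA.
Qed.

Definition sconst (W X : sSet) (x : X 0) : smap W X.
Proof.
by refine (@SMap W X (fun n _ => act (cst n ord0) x) _) => m n a w; rewrite act_cst.
Defined.

Lemma hmap_const (W X : sSet) (x : X 0) :
  hmap (@sconst W X x) = @fconst _ (hCat X) x.
Proof.
apply: hfunctor_eq => w w' e.
rewrite hmap_edge.
exact: (@arr_hedge_degen X _ _ x (edge_map (@sconst W X x) e) erefl).
Qed.

Lemma hpair_spair (W X Y : sSet) (f : smap W X) (g : smap W Y) :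
  fcomp (@hpair X Y) (fpair (hmap f) (hmap g)) = hmap (spair f g).
Proof.
apply: hprod_ext; rewrite fcompA ?hfst_hpair ?hsnd_hpair ?fst_fpair ?snd_fpair -hmap_comp;
  by congr hmap; apply: smap_eq.
Qed.

Lemma hom'_comp1m (A B : sSet) :
  fcomp (hom'_comp A B B) (fpair (@fconst _ (hom' B B) (vertex (@sid B))) fid) = fid.
Proof.
rewrite -(hmap_const (expS A B)) -(hmap_id (expS A B)) -fcompA hpair_spair -hmap_comp.
by congr hmap; apply: smap_eq => n f; apply: smap_eq.
Qed.

Lemma hom'_compm1 (A B : sSet) :
  fcomp (hom'_comp A A B) (fpair fid (@fconst _ (hom' A A) (vertex (@sid A)))) = fid.
Proof.
rewrite -(hmap_const (expS A B)) -(hmap_id (expS A B)) -fcompA hpair_spair -hmap_comp.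
congr hmap; apply: smap_eq => n f; apply: smap_eq => m [x b] /=.
by congr (f m (_, _)).
Qed.

Definition qCat2 : strict2cat :=
  @Strict2cat quasicategory (fun A B => hom' A B) (fun A => vertex (@sid A))
    (fun A B C => hom'_comp A B C) (fun A B C D => hom'_compA A B C D)
    (fun A B => hom'_comp1m A B) (fun A B => hom'_compm1 A B).

(* The 1-cells A -> B of [qCat2] are the vertices of B^A; this is the one given by a
   functor w : A -> B. *)
Definition onecell (A B : quasicategory) (w : smap A B) : @hom2 qCat2 A B := vertex w.

Lemma onecell_bij (A B : quasicategory) (v : @hom2 qCat2 A B) :
  exists! w : smap A B, onecell w = v.
Proof.
have dP (m : nat) (a : delta m 0) : a = cst m ord0.
  by apply: delta_eq => i; rewrite [LHS]ord1 [RHS]ord1.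
pose v' : smap (prodS A (Delta 0)) B := v.
have iP m n (a : delta m n) (x : A n) :
    (act a x, cst m ord0) = act a ((x, cst n ord0) : prodS A (Delta 0) n).
  by congr pair; apply/esym/dP.
pose i := @SMap A (prodS A (Delta 0)) (fun n x => (x, cst n ord0)) iP.
exists (scomp v' i); split=> [|w wv].
  by apply: (@smap_eq (prodS A (Delta 0)) B) => n [x a] /=; rewrite (dP n a).
by rewrite /v' -wv; apply: smap_eq.
Qed.

Lemma onecell_comp (A B C : quasicategory) (g : smap B C) (f : smap A B) :
  onecell (scomp g f) = @comp2 qCat2 A B C (onecell g, onecell f).
Proof. exact: (@smap_eq (prodS A (Delta 0)) C). Qed.

(* Weak equivalences of the Joyal model structure, i.e. weak categorical equivalences:
   the maps that mapping into any quasi-category turns into equivalences of homotopy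
   categories. *)
Definition joyal_weak_equivalence (X Y : sSet) (w : smap X Y) :=
  forall Q : quasicategory, equivalence_of_categories (hmap (exp_pre Q w)).

(* Main.v *)
(* Precomposition with [u] is the functor [comp2 (-, u)].  Hence an invertible 2-cell
   [u ~ u'] induces a natural isomorphism [h(Q^u) ~ h(Q^u')], which turns an equivalence
   of [qCat2] into equivalences of categories.  Conversely, essential surjectivity of
   [h(A^w)] gives [w'] with [w' w ~ id]; whiskering with [w] gives [(w w') w ~ id w],
   and [h(B^w)] reflects this to [w w' ~ id]. *)
From mathcomp Require Import all_boot.
Require Import Defs.

Set Implicit Arguments.
Unset Strict Implicit.
Unset Printing Implicit Defensive.

Definition isomorphic (C : category) (x y : C) := exists f : hom x y, is_iso f.

Lemma isomorphic_sym (C : category) (x y : C) : isomorphic x y -> isomorphic y x.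
Proof. by case=> f [g [gf fg]]; exists g, f. Qed.

Lemma isomorphic_trans (C : category) (x y z : C) :
  isomorphic x y -> isomorphic y z -> isomorphic x z.
Proof.
move=> [f [f' [f'f ff']]] [g [g' [g'g gg']]].
exists (comp g f), (comp f' g'); split.
- by rewrite compA -(compA g) g'g compm1.
- by rewrite compA -(compA f') ff' compm1.
Qed.

Lemma fhom_iso (C D : category) (F : functor C D) (x y : C) (f : hom x y) :
  is_iso f -> is_iso (fhom F f).
Proof. by case=> g [gf fg]; exists (fhom F g); rewrite -!fhom_comp gf fg !fhom_id. Qed.

Lemma fobj_isomorphic (C D : category) (F : functor C D) (x y : C) :
  isomorphic x y -> isomorphic (F x) (F y).
Proof. by case=> f /(fhom_iso F) Ff; exists (fhom F f). Qed.

Lemma nat_iso_isomorphic (C D : category) (F G : functor C D) (x : C) :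
  nat_iso F G -> isomorphic (F x) (G x).
Proof. by case=> t [_ tI]; exists (t x). Qed.

Lemma equivalence_surj (C D : category) (F : functor C D) (d : D) :
  equivalence_of_categories F -> exists c : C, isomorphic (F c) d.
Proof. by case=> G [_ FG]; exists (G d); apply: nat_iso_isomorphic d FG. Qed.

(** A quasi-inverse [G] carries the given isomorphism to one between [G (F x)] and [G (F y)], and
    the components of [G F ~ id] identify these with [x] and [y]. *)
Lemma equivalence_reflects (C D : category) (F : functor C D) (x y : C) :
  equivalence_of_categories F -> isomorphic (F x) (F y) -> isomorphic x y.
Proof.
move=> [G [GF _]] /(fobj_isomorphic G) GFxy.
apply: isomorphic_trans (nat_iso_isomorphic y GF).
exact: isomorphic_trans (isomorphic_sym (nat_iso_isomorphic x GF)) GFxy.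
Qed.

Lemma nat_iso_fix2 (C D E : category) (F : functor (prodC C D) E) (d d' : D) :
  isomorphic d d' ->
  nat_iso (fcomp F (fpair fid (fconst C d))) (fcomp F (fpair fid (fconst C d'))).
Proof.
move=> [f [g [gf fg]]].
(* Naturality holds because [(k, id)] and [(id, f)] commute in the product category. *)
exists (fun x => @fhom _ _ F (x, d) (x, d') (idm x, f)); split=> [x y k|x] /=.
  by rewrite -!fhom_comp /= !comp1m !compm1.
by apply: fhom_iso; exists (idm x, g); rewrite /= !comp1m gf fg.
Qed.

(** The constant functor at [vertex u] is [hmap] of a constant simplicial map, so both sides are
    [hmap] of simplicial maps that agree on every simplex. *)
Lemma hmap_exp_pre (A B Q : sSet) (u : smap A B) :
  hmap (exp_pre Q u)
  = fcomp (hom'_comp A B Q) (fpair fid (@fconst _ (hom' A B) (vertex u))).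
Proof.
rewrite -(hmap_const (expS B Q)) -(hmap_id (expS B Q)) -fcompA hpair_spair -hmap_comp.
by congr hmap; apply: smap_eq => n f; apply: smap_eq.
Qed.

Lemma hmap_exp_pre_id (A Q : sSet) : hmap (exp_pre Q (@sid A)) = fid.
Proof. by rewrite hmap_exp_pre hom'_compm1. Qed.

Lemma hmap_exp_pre_comp (A B C Q : sSet) (v : smap B C) (u : smap A B) :
  hmap (exp_pre Q (scomp v u)) = fcomp (hmap (exp_pre Q u)) (hmap (exp_pre Q v)).
Proof. by rewrite -hmap_comp; congr hmap; apply: smap_eq => n f; apply: smap_eq. Qed.

Lemma nat_iso_exp_pre (A B Q : sSet) (u u' : smap A B) :
  @isomorphic (hom' A B) (vertex u) (vertex u') ->
  nat_iso (hmap (exp_pre Q u)) (hmap (exp_pre Q u')).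
Proof. by move=> uu'; rewrite !hmap_exp_pre; apply: nat_iso_fix2. Qed.

Lemma exp_pre_vertex (A B Q : sSet) (u : smap A B) (v : smap B Q) :
  exp_pre Q u 0 (vertex v) = vertex (scomp v u).
Proof. exact: smap_eq. Qed.

(** Fixing [vertex v] as the first argument of [hom'_comp] gives a functor, which preserves
    isomorphisms. *)
Lemma isomorphic_whisker (A B C : sSet) (v : smap B C) (f g : smap A B) :
  @isomorphic (hom' A B) (vertex f) (vertex g) ->
  @isomorphic (hom' A C) (vertex (scomp v f)) (vertex (scomp v g)).
Proof.
move=> /(fobj_isomorphic (fcomp (hom'_comp A B C)
          (fpair (@fconst (hom' A B) (hom' B C) (vertex v)) fid))).
have vE k : vertex (scomp v k) = exp_comp A B C 0 (vertex v, vertex k).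
  exact: smap_eq.
by rewrite !vE.
Qed.

(** Every 1-cell comes from a unique simplicial map, so the inverse 1-cell may be taken to be
    one. *)
Lemma equivalence2_onecell (A B : quasicategory) (w : smap A B) :
  @equivalence2 qCat2 A B (onecell w) <->
  exists w' : smap B A,
    @isomorphic (hom' B B) (vertex (scomp w w')) (vertex sid)
    /\ @isomorphic (hom' A A) (vertex (scomp w' w)) (vertex sid).
Proof.
split=> [[v]|[w' ww']].
  have [w' [<- _]] := onecell_bij v.
  by rewrite -!onecell_comp => ww'; exists w'.
by exists (onecell w'); rewrite -!onecell_comp.
Qed.

Theorem proposition3p2p9 (A B : quasicategory) (w : smap A B) :
  joyal_weak_equivalence w <-> @equivalence2 qCat2 A B (onecell w).
Proof.
rewrite equivalence2_onecell; split=> [wE|[w' [ww' w'w]] Q].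
  have [v] := @equivalence_surj _ (hom' A A) _ (vertex sid) (wE A).
  have [w' [<- _]] := @onecell_bij B A v.
  (* On objects, [hmap] is by definition the map in degree 0. *)
  rewrite [fobj _ _]exp_pre_vertex => w'w; exists w'; split=> //.
  apply: (equivalence_reflects (wE B)).
  rewrite ![fobj _ _]exp_pre_vertex.
  have -> : scomp (scomp w w') w = scomp w (scomp w' w) by exact: smap_eq.
  have -> : scomp sid w = scomp w sid by exact: smap_eq.
  exact: (isomorphic_whisker w w'w).
(* By contravariance, [w w'] gives the composite on [h(Q^B)] and [w' w] the one on [h(Q^A)]; the
   identity functors become [h(Q^id)]. *)
exists (hmap (exp_pre Q w')).
rewrite -!hmap_exp_pre_comp -!hmap_exp_pre_id.
by split; apply: nat_iso_exp_pre.
Qed.
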